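(* Let $\eta\le\frac12$ and $\xi\ge\frac1n$. Suppose there exists an $(\epsilon,0)$-node DP algorithm $\mathcal M$ such that for any balanced $\theta\in[2]^n$, on input $G\sim SBM(n,2,B,\theta)$, $$\mathbb P(\mathcal L(\mathcal M(G),\theta)\le\xi)\ge1-\eta,$$ where the randomness is over both the algorithm and the stochastic block model. Then $$\epsilon\succsim\log\left(\frac1\xi\right)+\frac{\log\left(\frac{1}{4\eta}\right)}{\xi n}.$$ In particular, if $\xi,\eta\asymp\frac{1}{\mathrm{poly}(n)}$, then $\epsilon\succsim\log n$. Moreover, if $\eta\asymp\frac{1}{\mathrm{poly}(n)}$ and $\xi\asymp\frac{1}{\log n}$, then $\epsilon\succsim\log(\log n)$.
   Context: Asymptotics: parameters may depend on $n$. $f\succsim g$ means $f(n)\ge c\,g(n)$ for all sufficiently large $n$, for a constant $c>0$; $f\asymp g$ means both $f\succsim g$ and $g\succsim f$. $\mathrm{poly}(n)$ denotes a quantity of order $\Theta(n^\alpha)$ for some constant $\alpha>0$, possibly different at each occurrence. $\mathcal G_n$ is the set of unweighted undirected graphs on $[n]$. $d_{node}(G,G')$ is the minimum number of nodes that must be rewired (row/column of the adjacency matrix changed) to turn $G'$ into $G$; $G\sim_{node}G'$ if $d_{node}(G,G')\le1$. A randomized algorithm $\mathcal M$ on $\mathcal G_n$ (here with values in $[2]^n$) is $(\epsilon,\delta)$-node DP if $\mathbb P(\mathcal M(G)\in S)\le e^\epsilon\mathbb P(\mathcal M(G')\in S)+\delta$ for all $G\sim_{node}G'$ and measurable $S$.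 $\theta\in[k]^n$ is balanced if $|\{i:\theta_i=j\}|=n/k$ for all $j$. For symmetric invertible $B\in(0,1]^{k\times k}$, $SBM(n,k,B,\theta)$ is the random graph whose adjacency matrix has independent $A_{ij}\sim\mathrm{Ber}(B_{\theta_i,\theta_j})$ for $i<j$, $A_{ji}=A_{ij}$, zero diagonal. $\mathcal L(\hat\theta,\theta)=\min_{\sigma\in S_k}\frac2n\sum_{i=1}^n\mathbf 1\{\sigma(\hat\theta_i)\ne\theta_i\}$, with $S_k$ the permutation group of $[k]$; here $k=2$.
   Formalization: The displayed bound is claimed only when ξ ≤ 1−κ for large n, for some constant κ>0 (it fails at ξ=1, where a constant algorithm has ε=0); the other two claims need no such condition. Also η>0 is assumed, and ''large n'' means large even n. *)

(* Defs.v *)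
From mathcomp Require Import all_boot all_order all_algebra all_fingroup.
From mathcomp Require Import all_classical all_reals all_analysis.

Set Implicit Arguments.
Unset Strict Implicit.
Unset Printing Implicit Defensive.

Import Order.TTheory GRing.Theory Num.Theory.

Local Open Scope ring_scope.

(** Asymptotic comparison along a filter [F] on nat. No absolute values are
    taken, so this differs from the Landau notations of mathcomp-analysis when
    the functions are not nonnegative. *)
Section Asymptotics.
Variables (R : realType) (F : set_system nat).
Implicit Types f g : nat -> R.

Definition gtrsim f g : Prop :=
  exists2 c : R, 0 < c & \forall n \near F, c * g n <= f n.

Definition asymp_eq f g : Prop := gtrsim f g /\ gtrsim g f.

(** [f] is of order 1 / poly(n), i.e. of order n^-alpha for some alpha > 0. *)
Definition asymp_inv_poly f : Prop :=
  exists2 alpha : R, 0 < alpha & asymp_eq f (fun n => (n%:R `^ alpha)^-1).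

End Asymptotics.

(** Balanced labellings in [2]^n exist only for even n, so "n large" means
    "n large and even". *)
Definition even_infty : set_system nat := within [set n | ~~ odd n]%classic \oo%classic.

(** Graphs on [n], given by their (Boolean) adjacency matrices. *)
Definition graph (n : nat) :=
  {A : 'M[bool]_n | (A^T == A) && [forall i, ~~ A i i]}.

Definition adj n (G : graph n) (i j : 'I_n) : bool := sval G i j.

(** Rewiring the nodes of [S] may change the rows and columns of the adjacency
    matrix indexed by [S], and nothing else. *)
Definition rewires_to n (S : {set 'I_n}) (G' G : graph n) : bool :=
  [forall i, forall j,
    (i \notin S) && (j \notin S) ==> (adj G' i j == adj G i j)].

Definition d_node n (G G' : graph n) : nat :=
  #|[arg min_(S < [set: 'I_n] | rewires_to S G' G) #|S| ]|.

Definition node_adjacent n (G G' : graph n) : bool := (d_node G G' <= 1)%N.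

(** Probability distributions on a finite type. *)
Record distr (R : realType) (T : finType) := Distr {
  pmf :> T -> R;
  pmf_ge0 : forall x, 0 <= pmf x;
  pmf_sum1 : \sum_x pmf x = 1 }.

Definition prob (R : realType) (T : finType) (mu : distr R T) (S : {set T}) : R :=
  \sum_(x in S) mu x.

(** A randomized algorithm maps each input graph to the law of its output. *)
Definition algorithm (R : realType) (n : nat) (T : finType) :=
  graph n -> distr R T.

Definition node_dp (R : realType) (n : nat) (T : finType) (eps delta : R)
    (M : algorithm R n T) : Prop :=
  forall G G' : graph n, node_adjacent G G' -> forall S : {set T},
    prob (M G) S <= expR eps * prob (M G') S + delta.

Definition labelling (n k : nat) := {ffun 'I_n -> 'I_k}.

(** Every community has exactly n / k members; in particular k divides n. *)
Definition balanced n k (theta : labelling n k) : bool :=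
  [forall j, #|[set i | theta i == j]| * k == n]%N.

Definition connectivity (R : realType) k (B : 'M[R]_k) : Prop :=
  [/\ B^T = B, B \in unitmx & forall a b, 0 < B a b <= 1].

Definition bernoulli_mass (R : realType) (p : R) (b : bool) : R :=
  if b then p else 1 - p.

(** Probability that SBM(n, k, B, theta) equals [G]: the entries above the
    diagonal are independent, and they determine the graph. *)
Definition sbm_mass (R : realType) n k (B : 'M[R]_k) (theta : labelling n k)
    (G : graph n) : R :=
  \prod_(i < n) \prod_(j < n | (i < j)%N)
    bernoulli_mass (B (theta i) (theta j)) (adj G i j).

(** Probability that the output of [M] on G ~ SBM(n, k, B, theta) lies in [S],
    over the randomness of both the model and the algorithm. *)
Definition sbm_prob (R : realType) n k (T : finType) (B : 'M[R]_k)
    (theta : labelling n k) (M : algorithm R n T) (S : {set T}) : R :=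
  \sum_(G : graph n) sbm_mass B theta G * prob (M G) S.

Definition mismatch (R : realType) n k (that theta : labelling n k)
    (sigma : 'S_k) : R :=
  2 / n%:R * \sum_(i < n) (sigma (that i) != theta i)%:R.

(** The first argument of the iterated minimum is its default value; taking it
    at the identity permutation leaves the minimum over 'S_k unchanged. *)
Definition loss (R : realType) n k (that theta : labelling n k) : R :=
  \big[Num.min/mismatch R that theta 1%g]_(sigma : 'S_k)
    mismatch R that theta sigma.

(* Main.v *)
Require Import Defs.
From mathcomp Require Import all_boot all_order all_algebra all_fingroup.
From mathcomp Require Import all_classical all_reals all_analysis.
From mathcomp Require Import zify ring lra.

(** Write n = 2N. The proof compares one reference model with a whole family of
    models that are close to it.

    If two labellings agree off a set of d nodes, then the two block models can
    be coupled so that the graphs differ by a rewiring of these d nodes, and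
    group privacy bounds the probability of any event on the output under one
    model by e^(d eps) times its probability under the other
    ([sbm_prob_le]). Take a finite family of balanced labellings, each within d
    nodes of a reference, such that every output is xi-accurate for at most a
    fraction p of the family. Transporting the accuracy guarantee of each member
    to the reference model and averaging over the family gives
    1 - eta <= e^(d eps) p, and doing the same with the failure events gives
    1 - p <= e^(d eps) eta ([averaged_accuracy]). The first inequality yields
    the log (1 / xi) term and the second one the log (1 / (4 eta)) term.

    The families are built from the pairs of nodes {2k, 2k+1}. The reference
    gives the two nodes of a pair different labels; swapping these labels on any
    set of pairs keeps the labelling balanced. The fraction p is bounded by
    Chernoff's method, since the number of errors is a sum of independent
    contributions ([chernoff_count]).
    - If xi is small, take m of order xi N blocks of l of order 1 / xi pairs, and
      swap exactly one pair per block. An output is close to at most one of the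
      l choices in each block, so p is about l^(-m/2), while d = 2m
      ([sparse_bound]).
    - If xi is bounded away from 0 and from 1, swap an arbitrary set of pairs.
      A pair contributes on average one error whatever the output is, so being
      correct on more than half of the nodes by a constant fraction has
      probability p exponentially small in N, while d = n ([dense_bound]).
      Packings are useless here: for xi >= 1/2 no two balanced labellings have
      disjoint sets of accurate outputs.

    Both regimes are combined in [privacy_bound], whose constant depends on the
    distance of xi to 1 only. The last two claims follow because both rates
    make xi and eta vanish, so that the second term is nonnegative and
    log (1 / xi) dominates a multiple of log n or of log log n. *)

Import Order.TTheory GRing.Theory Num.Theory.

Local Open Scope ring_scope.

Set Implicit Arguments.
Unset Strict Implicit.
Unset Printing Implicit Defensive.

(** * Graphs and node rewiring *)

Lemma adj_sym n (G : graph n) i j : adj G i j = adj G j i.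
Proof.
case: G => A /=; rewrite /adj /= => /andP[/eqP AT _].
by rewrite -{1}AT mxE.
Qed.

Lemma adj_irr n (G : graph n) i : adj G i i = false.
Proof.
by case: G => A /=; rewrite /adj /= => /andP[_ /forallP/(_ i)/negbTE].
Qed.

Definition graph_of_rel_mx n (r : 'I_n -> 'I_n -> bool) : 'M[bool]_n :=
  \matrix_(i, j) [|| (i < j)%N && r i j | (j < i)%N && r j i].

Lemma graph_of_rel_subproof n (r : 'I_n -> 'I_n -> bool) :
  ((graph_of_rel_mx r)^T == graph_of_rel_mx r)
    && [forall i, ~~ graph_of_rel_mx r i i].
Proof.
apply/andP; split.
- by apply/eqP/matrixP => i j; rewrite !mxE orbC.
- by apply/forallP => i; rewrite !mxE !ltnn.
Qed.

Definition graph_of_rel n (r : 'I_n -> 'I_n -> bool) : graph n :=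
  exist _ (graph_of_rel_mx r) (graph_of_rel_subproof r).

Lemma adj_graph_of_rel n (r : 'I_n -> 'I_n -> bool) (i j : 'I_n) : (i < j)%N ->
  adj (graph_of_rel r) i j = r i j.
Proof. by move=> ij; rewrite /adj /= mxE ij ltnNge (ltnW ij) orbF. Qed.

Lemma graph_eq n (G G' : graph n) :
  (forall i j : 'I_n, (i < j)%N -> adj G i j = adj G' i j) -> G = G'.
Proof.
move=> E; apply/val_inj/matrixP => i j; rewrite -!/(adj _ _ _).
case: (ltngtP i j) => [/E //|/E|/val_inj ->]; last by rewrite !adj_irr.
by rewrite adj_sym => ->; rewrite adj_sym.
Qed.

Lemma rewires_to_refl n (G : graph n) (S : {set 'I_n}) : rewires_to S G G.
Proof. by apply/forallP => i; apply/forallP => j; apply/implyP. Qed.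

Lemma rewires_toP n (S : {set 'I_n}) (G' G : graph n) :
  reflect (forall i j : 'I_n, (i < j)%N -> i \notin S -> j \notin S ->
             adj G' i j = adj G i j)
          (rewires_to S G' G).
Proof.
apply: (iffP forallP) => [E i j _ iS jS|E i].
  by have /forallP/(_ j)/implyP := E i; rewrite iS jS => /(_ isT)/eqP.
apply/forallP => j; apply/implyP => /andP[iS jS]; apply/eqP.
case: (ltngtP i j) => [ij|ji|/val_inj ->]; last by rewrite !adj_irr.
- exact: E.
- by rewrite adj_sym E // adj_sym.
Qed.

Lemma node_adjacent_rewire n (i : 'I_n) (G G' : graph n) :
  rewires_to [set i] G' G -> node_adjacent G G'.
Proof.
move=> E; rewrite /node_adjacent /d_node; case: arg_minnP.
  by apply/rewires_toP => a b _; rewrite inE.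
by move=> S _ /(_ _ E); rewrite cards1.
Qed.

(** Group privacy: the nodes of [S] are rewired one at a time, and each step
    costs a factor e^eps. *)
Lemma node_dp_group (R : realType) n (T : finType) (eps : R)
    (M : algorithm R n T) (S : {set 'I_n}) (G G' : graph n) (U : {set T}) :
  node_dp eps 0 M -> rewires_to S G' G ->
  prob (M G) U <= expR (#|S|%:R * eps) * prob (M G') U.
Proof.
move=> dp; move: {2}#|S| (erefl #|S|) => d; elim: d S G => [|d IH] S G cS E.
  rewrite cS mul0r expR0 mul1r.
  suff -> : G = G' by [].
  apply/esym/graph_eq => i j ij.
  by have/rewires_toP := E; apply => //; rewrite (cards0_eq cS) inE.
have /card_gt0P[v vS] : (0 < #|S|)%N by rewrite cS.
(* [G1] already agrees with [G'] at node [v], and with [G] elsewhere. *)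
pose G1 := graph_of_rel (fun i j =>
  if (i == v) || (j == v) then adj G' i j else adj G i j).
have G1E (i j : 'I_n) : (i < j)%N ->
    adj G1 i j = if (i == v) || (j == v) then adj G' i j else adj G i j.
  exact: adj_graph_of_rel.
have cSv : #|S :\ v| = d by move: cS; rewrite (cardsD1 v) vS => -[].
have adjGG1 : node_adjacent G G1.
  apply: (@node_adjacent_rewire _ v); apply/rewires_toP => i j ij.
  by rewrite !inE G1E // => /negbTE-> /negbTE->.
have E1 : rewires_to (S :\ v) G' G1.
  apply/rewires_toP => i j ij; rewrite !inE G1E // !negb_and !negbK.
  case: eqP => //= _ iS; case: eqP => //= _ jS.
  by move/rewires_toP : E; apply.
have := dp _ _ adjGG1 U; rewrite addr0 => /le_trans; apply.
rewrite cS -natr1 mulrDl mul1r addrC expRD -mulrA ler_wpM2l ?expR_ge0 //.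
by rewrite -cSv IH.
Qed.

(** A graph is a free choice of the bits above the diagonal, so a sum over
    graphs of a product over edges factorizes. *)
Lemma sum_graph_prod (R : comNzRingType) n (c : 'I_n -> 'I_n -> bool -> R) :
  \sum_(G : graph n) \prod_(i < n) \prod_(j < n | (i < j)%N) c i j (adj G i j)
    = \prod_(i < n) \prod_(j < n | (i < j)%N) (c i j true + c i j false).
Proof.
(* The masks of the bits above the diagonal are the families supported
   there; [false] is the default value elsewhere. *)
pose P := [pred x : 'I_n * 'I_n | (x.1 < x.2)%N].
rewrite (eq_bigr (fun G => \prod_(x | P x) c x.1 x.2 (adj G x.1 x.2))).
  2: by move=> G _; rewrite pair_big_dep.
rewrite pair_big_dep /=.
rewrite [RHS](eq_bigr (fun x => \sum_(b : bool) c x.1 x.2 b)).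
  2: by move=> x _; rewrite big_bool.
rewrite (big_distr_big_dep false) /=.
pose h (f : {ffun 'I_n * 'I_n -> bool}) := graph_of_rel (fun i j => f (i, j)).
pose h' (G : graph n) :=
  [ffun x : 'I_n * 'I_n => (x.1 < x.2)%N && adj G x.1 x.2].
rewrite [LHS](reindex_onto h h').
  2: by move=> G _; apply: graph_eq => i j ij; rewrite adj_graph_of_rel // ffunE ij.
apply: eq_big => [f|f _].
- apply/eqP/pfamilyP => [<-|[supp _]].
    split=> [|x _ /=]; last by [].
    by apply/supportP => x; rewrite unfold_in /= ffunE => /negbTE->.
  apply/ffunP => -[i j]; rewrite ffunE /=.
  case: ltnP => ij /=; first by rewrite adj_graph_of_rel.
  by rewrite (supportP supp) // unfold_in /= -leqNgt.
- by apply: eq_bigr => -[i j] /= ij; rewrite adj_graph_of_rel.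
Qed.

(** * Replacing one stochastic block model by another *)

Section SBM.
Variables (R : realType) (n k : nat) (B : 'M[R]_k).
Hypothesis B01 : forall a b, 0 < B a b <= 1.
Implicit Types (theta : labelling n k) (G : graph n) (D : {set 'I_n}).

Let bern theta (i j : 'I_n) := bernoulli_mass (B (theta i) (theta j)).

Let bern_ge0 theta i j b : 0 <= bern theta i j b.
Proof.
rewrite /bern /bernoulli_mass; have /andP[p0 p1] := B01 (theta i) (theta j).
by case: b; rewrite ?subr_ge0 // ltW.
Qed.

Let bern_sum theta i j : bern theta i j true + bern theta i j false = 1.
Proof. by rewrite /bern /bernoulli_mass addrC subrK. Qed.

Lemma sbm_mass_ge0 theta G : 0 <= sbm_mass B theta G.
Proof. by apply: prodr_ge0 => i _; apply: prodr_ge0 => j _; exact: bern_ge0. Qed.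

Lemma sbm_mass_sum1 theta : \sum_G sbm_mass B theta G = 1.
Proof.
rewrite (sum_graph_prod (bern theta)).
by rewrite big1 // => i _; rewrite big1 // => j _; exact: bern_sum.
Qed.

Let touches D (i j : 'I_n) := (i \in D) || (j \in D).

(** The mass of a block model is split into the factor of the edges with no
    endpoint in [D], which a rewiring of [D] does not change, and the factor of
    the edges that meet [D]. *)
Definition inner_mass theta D G : R :=
  \prod_(i < n) \prod_(j < n | (i < j)%N)
    if touches D i j then 1 else bern theta i j (adj G i j).

Definition outer_mass theta D G : R :=
  \prod_(i < n) \prod_(j < n | (i < j)%N)
    if touches D i j then bern theta i j (adj G i j) else 1.

Lemma sbm_mass_split theta D G :
  sbm_mass B theta G = inner_mass theta D G * outer_mass theta D G.
Proof.
rewrite /sbm_mass -big_split; apply: eq_bigr => i _.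
rewrite -big_split; apply: eq_bigr => j _ /=.
by case: ifP; rewrite ?mul1r ?mulr1.
Qed.

Lemma inner_mass_ge0 theta D G : 0 <= inner_mass theta D G.
Proof.
apply: prodr_ge0 => i _; apply: prodr_ge0 => j _.
by case: ifP => // _; exact: bern_ge0.
Qed.

Lemma outer_mass_ge0 theta D G : 0 <= outer_mass theta D G.
Proof.
apply: prodr_ge0 => i _; apply: prodr_ge0 => j _.
by case: ifP => // _; exact: bern_ge0.
Qed.

Lemma inner_mass_rewire theta theta' D G G' :
  {in ~: D, theta =1 theta'} -> rewires_to D G' G ->
  inner_mass theta D G = inner_mass theta' D G'.
Proof.
move=> E /rewires_toP EG; apply: eq_bigr => i _; apply: eq_bigr => j ij.
case: ifP => // /negbT; rewrite negb_or => /andP[iD jD].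
by rewrite EG // /bern !E // inE.
Qed.

(** The graphs obtained from [G] by rewiring [D] are a free choice of the
    edges that meet [D]. The indicator of this event is itself a product over
    edges, which reduces the claim to [sum_graph_prod]. *)
Lemma outer_mass_sum1 theta D G :
  \sum_(G' | rewires_to D G' G) outer_mass theta D G' = 1.
Proof.
pose c i j b :=
  if touches D i j then bern theta i j b else (b == adj G i j)%:R.
rewrite big_mkcond.
rewrite (eq_bigr (fun G' => \prod_(i < n) \prod_(j < n | (i < j)%N)
                              c i j (adj G' i j))) => [|G' _].
  rewrite sum_graph_prod big1 // => i _; rewrite big1 // => j _; rewrite /c.
  by case: ifP => _; [exact: bern_sum | case: adj; rewrite ?addr0 ?add0r].
case: rewires_toP => [E|nE].
  apply: eq_bigr => i _; apply: eq_bigr => j ij; rewrite /c.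
  by case: ifP => // /negbT; rewrite negb_or => /andP[iD jD]; rewrite E ?eqxx.
apply/esym/eqP; apply: contra_notT nE => + i j ij iD jD.
move=> /prodf_neq0/(_ i isT)/prodf_neq0/(_ j ij).
rewrite /c /touches (negbTE iD) (negbTE jD) /=.
by rewrite pnatr_eq0 eqb0 negbK => /eqP.
Qed.

Lemma rewires_to_sym D G G' : rewires_to D G G' = rewires_to D G' G.
Proof. by apply/rewires_toP/rewires_toP => E i j *; rewrite E. Qed.

(** The two models are coupled by drawing the edges off [D] once, and the edges
    that meet [D] independently from each model; the two graphs of a coupled
    pair are then related by a rewiring of [D]. *)
Lemma sbm_mean_le theta theta' D (f : graph n -> R) (c : R) :
  {in ~: D, theta =1 theta'} ->
  (forall G G', rewires_to D G' G -> f G <= c * f G') ->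
  \sum_G sbm_mass B theta G * f G <= c * \sum_G sbm_mass B theta' G * f G.
Proof.
move=> E fc.
pose w theta1 G theta2 G' :=
  inner_mass theta1 D G * outer_mass theta1 D G * outer_mass theta2 D G'.
have -> : \sum_G sbm_mass B theta G * f G =
    \sum_G \sum_(G' | rewires_to D G' G) w theta G theta' G' * f G.
  apply: eq_bigr => G _; rewrite (sbm_mass_split theta D).
  by rewrite -big_distrl -big_distrr /= outer_mass_sum1 mulr1.
have -> : \sum_G sbm_mass B theta' G * f G =
    \sum_G' \sum_(G | rewires_to D G' G) w theta G theta' G' * f G'.
  apply: eq_bigr => G' _; rewrite (sbm_mass_split theta' D) -big_distrl /=.
  congr (_ * _); rewrite -[LHS]mulr1 -(outer_mass_sum1 theta D G') big_distrr /=.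
  apply: eq_big => [G|G E']; first exact: rewires_to_sym.
  rewrite /w mulrAC; congr (_ * _ * _); apply/esym/inner_mass_rewire => //.
  by rewrite rewires_to_sym.
rewrite (exchange_big_dep predT) //= big_distrr /=; apply: ler_sum => G' _.
rewrite big_distrr /=; apply: ler_sum => G E'.
rewrite mulrCA ler_wpM2l ?fc // /w !mulr_ge0 ?inner_mass_ge0 ?outer_mass_ge0 //.
Qed.

Lemma sbm_prob_le (T : finType) (eps : R) (M : algorithm R n T) theta theta' D
    (U : {set T}) :
  node_dp eps 0 M -> {in ~: D, theta =1 theta'} ->
  sbm_prob B theta M U <= expR (#|D|%:R * eps) * sbm_prob B theta' M U.
Proof. by move=> dp E; apply: sbm_mean_le E _ => G G'; exact: node_dp_group. Qed.

Lemma sbm_prob_sum (T : finType) (M : algorithm R n T) theta (U : {set T}) :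
  sbm_prob B theta M U = \sum_(x in U) sbm_prob B theta M [set x].
Proof.
rewrite /sbm_prob exchange_big; apply: eq_bigr => G _ /=.
rewrite -big_distrr /=; congr (_ * _); apply: eq_bigr => x _.
by rewrite /prob big_set1.
Qed.

Lemma sbm_prob_ge0 (T : finType) (M : algorithm R n T) theta (U : {set T}) :
  0 <= sbm_prob B theta M U.
Proof.
apply: sumr_ge0 => G _; rewrite mulr_ge0 ?sbm_mass_ge0 //.
by apply: sumr_ge0 => x _; exact: Defs.pmf_ge0.
Qed.

Lemma sbm_prob_setT (T : finType) (M : algorithm R n T) theta :
  sbm_prob B theta M [set: T] = 1.
Proof.
rewrite -(sbm_mass_sum1 theta); apply: eq_bigr => G _; rewrite /prob.
under eq_bigl do rewrite inE.
by rewrite Defs.pmf_sum1 mulr1.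
Qed.

Lemma sbm_prob_setC (T : finType) (M : algorithm R n T) theta (U : {set T}) :
  sbm_prob B theta M (~: U) = 1 - sbm_prob B theta M U.
Proof.
rewrite -(sbm_prob_setT M theta) !(sbm_prob_sum M theta).
apply/esym/eqP; rewrite subr_eq addrC (bigID (mem U)) /=; apply/eqP.
by congr (_ + _); apply: eq_bigl => x; rewrite !inE.
Qed.

End SBM.

Lemma node_dp_ge0 (R : realType) n (T : finType) (eps : R) (M : algorithm R n T)
    (G : graph n) : node_dp eps 0 M -> 0 <= eps.
Proof.
move=> dp.
have GG : node_adjacent G G.
  rewrite /node_adjacent /d_node; case: arg_minnP.
    exact: rewires_to_refl.
  move=> S _ /(_ finset.set0 (rewires_to_refl _ _)).
  by rewrite cards0 => /leq_trans; apply.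
have := dp _ _ GG [set: T].
have -> : prob (M G) [set: T] = 1.
  by rewrite /prob -(Defs.pmf_sum1 (M G)); apply: eq_bigl => x; rewrite inE.
by rewrite addr0 mulr1 -{1}expR0 ler_expR.
Qed.

(** Everything is transported to the single model [theta0], where the fractions
    of the family for which an output is good can be averaged. The first
    conclusion transports the events [U a] and the second their complements. *)
Lemma averaged_accuracy (R : realType) n k (B : 'M[R]_k) (T A : finType) (eps eta p : R)
   (d : nat) (M : algorithm R n T) (theta0 : labelling n k)
   (theta : A -> labelling n k) (D : A -> {set 'I_n}) (U : A -> {set T}) :
  (forall a b, 0 < B a b <= 1) -> node_dp eps 0 M -> 
  (forall a, #|D a| <= d)%N ->
  (forall a, {in ~: D a, theta a =1 theta0}) ->
  (forall a, 1 - eta <= sbm_prob B (theta a) M (U a)) ->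
  (forall x, #|[set a | x \in U a]|%:R <= p * #|A|%:R) ->
  (0 < #|A|)%N ->
  1 - eta <= expR (d%:R * eps) * p /\ 1 - p <= expR (d%:R * eps) * eta.
Proof.
move=> B01 dp Dd Dtheta acc cover A0.
have A0R : 0 < #|A|%:R :> R by rewrite ltr0n.
have eps0 : 0 <= eps.
  by apply: (@node_dp_ge0 _ _ _ _ _ (graph_of_rel (fun _ _ => false)) dp).
have expd a : expR (#|D a|%:R * eps) <= expR (d%:R * eps).
  by rewrite ler_expR ler_wpM2r // ler_nat.
have avg : \sum_a sbm_prob B theta0 M (U a) <= p * #|A|%:R.
  under eq_bigr do rewrite sbm_prob_sum.
  rewrite (exchange_big_dep predT) //= -[leRHS]mul1r.
  have total : \sum_x sbm_prob B theta0 M [set x] = 1.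
    rewrite -[RHS](sbm_prob_setT B M theta0) sbm_prob_sum.
    by apply: eq_bigl => x; rewrite inE.
  rewrite -[X in X * _]total big_distrl /=.
  apply: ler_sum => x _; rewrite sumr_const -[leLHS]mulr_natr.
  rewrite ler_wpM2l ?sbm_prob_ge0 //; apply: le_trans (cover x).
  by rewrite cardsE.
split; rewrite -(ler_pM2r A0R).
- rewrite -mulrA; apply: le_trans (ler_wpM2l (expR_ge0 _) avg).
  rewrite big_distrr /= [leLHS]mulr_natr -sumr_const; apply: ler_sum => a _.
  apply: le_trans (acc a) _; apply: le_trans (sbm_prob_le B01 _ dp (Dtheta a)) _.
  by rewrite ler_wpM2r ?sbm_prob_ge0.
- rewrite mulrBl mul1r.
  apply: (@le_trans _ _ (\sum_a sbm_prob B theta0 M (~: U a))).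
    under eq_bigr do rewrite sbm_prob_setC.
    by rewrite big_split sumrN /= sumr_const lerB.
  rewrite [leRHS]mulr_natr -sumr_const; apply: ler_sum => a _.
  have E a' : {in ~: D a', theta0 =1 theta a'} by move=> i /(Dtheta a') ->.
  apply: le_trans (sbm_prob_le B01 _ dp (E a)) _.
  rewrite ler_pM ?expR_ge0 ?sbm_prob_ge0 // sbm_prob_setC.
  by have := acc a; lra.
Qed.

(** * Swap labellings and counting *)

(** The exponential Markov inequality, for the uniform distribution on words
    of length [m]: the generating function of a sum of functions of the letters
    is a product. *)
Lemma chernoff_count (R : realType) (A : finType) m (h : 'I_m -> A -> nat)
    (lambda r : R) : 0 <= lambda ->
  #|[set a : {ffun 'I_m -> A} | (\sum_j h j (a j))%N%:R <= r]|%:R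
    <= expR (lambda * r) * \prod_j \sum_b expR (- lambda * (h j b)%:R).
Proof.
move=> lambda0; rewrite bigA_distr_bigA big_distrr /=.
rewrite -sum1dep_card natr_sum big_mkcond /=; apply: ler_sum => a _.
rewrite -expR_sum -expRD -mulr_sumr -natr_sum.
case: ifP => [ha|_]; last exact: expR_ge0.
by rewrite -[leLHS]expR0 ler_expR mulNr -mulrBr mulr_ge0 // subr_ge0.
Qed.

(** At most one letter can satisfy h <= 1, since two such letters would
    contradict the hypothesis; all others satisfy h >= 2. *)
Lemma sum_expR_separated (R : realType) (A : finType) (h : A -> nat)
    (lambda : R) : 0 <= lambda ->
  (forall a b, a != b -> 4 <= h a + h b)%N ->
  \sum_b expR (- lambda * (h b)%:R) <= 1 + #|A|%:R * expR (- lambda * 2).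
Proof.
move=> lambda0 sep.
have far b : (1 < h b)%N -> expR (- lambda * (h b)%:R) <= expR (- lambda * 2).
  by move=> hb; rewrite ler_expR !mulNr lerN2 ler_wpM2l // ler_nat.
have [b0 hb0|/= all_far] := pickP (fun b => h b <= 1)%N; last first.
  apply: ler_wpDl => //; rewrite mulr_natl -sumr_const; apply: ler_sum => b _.
  by rewrite far // ltnNge all_far.
rewrite (bigD1 b0) //= lerD //.
  by rewrite -[leRHS]expR0 ler_expR mulNr oppr_le0 mulr_ge0.
apply: (@le_trans _ _ (\sum_(b | b != b0) expR (- lambda * 2))).
  apply: ler_sum => b bb0; apply: far.
  by have := sep _ _ bb0; lia.
by rewrite sumr_const mulr_natl ler_wpMn2l ?expR_ge0 ?max_card.
Qed.

Definition disagree n k (that theta : labelling n k) : nat :=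
  (\sum_i (that i != theta i))%N.

Lemma loss_le_disagree (R : realType) n k (that theta : labelling n k) (xi : R) :
  (0 < n)%N -> loss R that theta <= xi ->
  exists sigma : 'S_k,
    (disagree [ffun i => sigma (that i)] theta)%:R <= xi * (n%:R / 2).
Proof.
move=> n0 le_xi.
have [sigma le_sigma] : exists sigma, mismatch R that theta sigma <= xi.
  apply: contra_leP le_xi => none; apply/bigmin_gtP.
  split=> [|sigma _]; rewrite ltNge; apply/negP => le_sigma; apply: none;
  by eexists; exact: le_sigma.
exists sigma; rewrite natr_sum.
rewrite -ler_pdivrMr ?divr_gt0 ?ltr0n // invf_div mulrC.
by under eq_bigr do rewrite ffunE.
Qed.

(** The loss minimizes over the two permutations of the labels, and permuting
    the labels of an output gives another output; this costs a factor 2 only. *)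
Lemma count_loss_le (R : realType) n (A : finType) (theta : A -> labelling n 2)
    (xi q : R) : (0 < n)%N ->
  (forall that : labelling n 2,
     #|[set a | (disagree that (theta a))%:R <= xi * (n%:R / 2)]|%:R <= q) ->
  forall that : labelling n 2,
    #|[set a | that \in [set t | loss R t (theta a) <= xi]]|%:R <= 2 * q.
Proof.
move=> n0 Hq that.
pose near_ (sigma : 'S_2) := [set a |
  (disagree [ffun i => sigma (that i)] (theta a))%:R <= xi * (n%:R / 2)].
have sub : [set a | that \in [set t | loss R t (theta a) <= xi]]
    \subset (\bigcup_sigma near_ sigma)%SET.
  apply/fintype.subsetP => a; rewrite !inE => /(loss_le_disagree n0)[sigma Hs].
  by apply/finset.bigcupP; exists sigma => //; rewrite inE.
apply: (@le_trans _ _ (\sum_(sigma : 'S_2) #|near_ sigma|)%N%:R).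
  rewrite ler_nat; apply: leq_trans (subset_leq_card sub) _.
  elim/big_rec2: _ => [|sigma k X _ le_k]; first by rewrite cards0.
  by rewrite (leq_trans (leq_card_setU _ _)) // leq_add2l.
rewrite natr_sum; apply: (@le_trans _ _ (\sum_(sigma : 'S_2) q)).
  by apply: ler_sum => sigma _; exact: Hq.
by rewrite sumr_const card_Sn mulr_natl.
Qed.

Section Swaps.
Variable N : nat.
Implicit Types (X : {set 'I_N}) (that : labelling N.*2 2).

Lemma node_subproof (k : 'I_N) (b : bool) : (b + k.*2 < N.*2)%N.
Proof. by case: b k => -[k] /=; lia. Qed.

(** Consecutive nodes are paired, so that halving and parity of the index recover
    the pair and the position in it. *)
Definition node k b : 'I_N.*2 := Ordinal (node_subproof k b).

Lemma pair_of_subproof (i : 'I_N.*2) : (i./2 < N)%N.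
Proof. by case: i => i /=; lia. Qed.

Definition pair_of i : 'I_N := Ordinal (pair_of_subproof i).

Lemma pair_of_node k b : pair_of (node k b) = k.
Proof. by apply/val_inj; rewrite /= half_bit_double. Qed.

Lemma odd_node k b : odd (node k b) = b.
Proof. by rewrite /= oddD odd_double oddb addbF. Qed.

Lemma node_pair_of i : node (pair_of i) (odd i) = i.
Proof. by apply/val_inj; rewrite /= odd_double_half. Qed.

Lemma big_nodes (T : Type) (idx : T) (op : Monoid.com_law idx)
    (F : 'I_N.*2 -> T) :
  \big[op/idx]_i F i = \big[op/idx]_k op (F (node k true)) (F (node k false)).
Proof.
rewrite (reindex (fun x => node x.1 x.2)) /=; last first.
  exists (fun i => (pair_of i, odd i)) => [[k b]|i] _ /=.
    by rewrite pair_of_node odd_node.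
  by rewrite node_pair_of.
rewrite -(pair_bigA _ (fun k b => F (node k b))) /=.
by apply: eq_bigr => k _; rewrite big_bool.
Qed.

Definition label (b : bool) : 'I_2 := if b then ord_max else ord0.

Definition swapped X : labelling N.*2 2 :=
  [ffun i : 'I_N.*2 => label (odd i (+) (pair_of i \in X))].

Lemma swapped_node X k b : swapped X (node k b) = label (b (+) (k \in X)).
Proof. by rewrite ffunE odd_node pair_of_node. Qed.

(** Each pair has one node of either label, whether it is swapped or not. *)
Lemma balanced_swapped X : balanced (swapped X).
Proof.
apply/forallP => j; rewrite cardsE -sum1_card big_mkcond /= big_nodes /=.
rewrite (eq_bigr (fun=> 1%N)) => [|k _].
  by rewrite sum_nat_const card_ord muln1 muln2.
rewrite !unfold_in !swapped_node.
by case: (k \in X); case: j => -[|[|]].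
Qed.

Definition pair_errors that k (b : bool) : nat :=
  (that (node k true) != label (~~ b)) + (that (node k false) != label b).

Lemma disagree_swapped that X :
  disagree that (swapped X) = (\sum_k pair_errors that k (k \in X))%N.
Proof.
rewrite /disagree big_nodes /=; apply: eq_bigr => k _.
by rewrite !swapped_node.
Qed.

(** Each of the two nodes is wrong for exactly one of the two states of its
    pair. This is what makes an output unable to be close to many swaps. *)
Lemma pair_errors_sum that k :
  (pair_errors that k true + pair_errors that k false = 2)%N.
Proof.
rewrite /pair_errors.
by case: (that (node k true)) => -[|[|]] //; case: (that (node k false)) => -[|[|]].
Qed.

Lemma swapped_eq0 X :
  {in ~: [set i | pair_of i \in X], swapped X =1 swapped finset.set0}.
Proof. by move=> i; rewrite !inE !ffunE inE => /negbTE->. Qed.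

Lemma card_pairs X : #|[set i | pair_of i \in X]| = #|X|.*2.
Proof.
rewrite cardsE -sum1_card big_mkcond big_nodes /=.
rewrite -[RHS]muln2 -sum1_card big_distrl /=.
rewrite [RHS]big_mkcond; apply: eq_bigr => k _ /=.
by rewrite !unfold_in !pair_of_node; case: ifP.
Qed.

End Swaps.

(** * Bounds for a fixed number of nodes *)

Lemma leq_sum_inj (I J : finType) (f : I -> J) (F : J -> nat) :
  injective f -> (\sum_i F (f i) <= \sum_j F j)%N.
Proof.
move=> f_inj; rewrite [leqRHS](bigID (mem [set f i | i in I])) /=.
by rewrite big_imset /= ?leq_addr // => x y _ _; exact: f_inj.
Qed.

(** Both exponentials are bounded through e^y >= 1 + y, which turns the left
    side into 2 / (1 - x^2); on [0, 1/2] this is at most 2 (1 + 4/3 x^2). *)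
Lemma coshR_le (R : realType) (x : R) : 0 <= x <= 1 / 2 ->
  expR x + expR (- x) <= 2 * expR (4 / 3 * x ^+ 2).
Proof.
move=> /andP[x0 x2].
have ex : expR x <= (1 - x)^-1.
  rewrite -[expR x]invrK -expRN lef_pV2 ?posrE ?expR_gt0 ?expR_ge1Dx //.
  by lra.
have eNx : expR (- x) <= (1 + x)^-1.
  by rewrite expRN lef_pV2 ?posrE ?expR_gt0 ?expR_ge1Dx //; lra.
apply: (@le_trans _ _ (2 * (1 + 4 / 3 * x ^+ 2))); last first.
  by rewrite ler_wpM2l // expR_ge1Dx.
apply: le_trans (lerD ex eNx) _.
have -> : (1 - x)^-1 + (1 + x)^-1 = 2 / (1 - x ^+ 2).
  by field; apply/andP; split; [|apply/andP; split]; rewrite gt_eqF //; nra.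
have y0 := sqr_ge0 x; have y4 : x ^+ 2 <= 1 / 4 by rewrite expr2; nra.
move: (x ^+ 2) y0 y4 => y y0 y4.
rewrite ler_pdivrMr; last by lra.
by have := mulr_ge0 y0 (_ : 0 <= 1 / 4 - y); rewrite subr_ge0 => /(_ y4); lra.
Qed.

Section LowerBound.
Variables (R : realType) (N : nat) (B : 'M[R]_2) (eps eta xi : R).
Variable M : algorithm R N.*2 (labelling N.*2 2).
Hypothesis N0 : (0 < N)%N.
Hypothesis B01 : forall a b, 0 < B a b <= 1.
Hypothesis eta_le : 0 < eta <= 2^-1.
Hypothesis xi_ge : (N.*2)%:R^-1 <= xi.
Hypothesis dp : node_dp eps 0 M.
Hypothesis acc : forall theta : labelling N.*2 2, balanced theta ->
  1 - eta <= sbm_prob B theta M [set that | loss R that theta <= xi].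

Lemma eps_ge0 : 0 <= eps.
Proof. exact: node_dp_ge0 (graph_of_rel (fun _ _ => false)) dp. Qed.

Lemma half_double : (N.*2)%:R / 2 = N%:R :> R.
Proof. by rewrite -muln2 natrM mulfK. Qed.

Lemma xi_gt0 : 0 < xi.
Proof. by apply: lt_le_trans xi_ge; rewrite invr_gt0 ltr0n double_gt0. Qed.

(** The form of [averaged_accuracy] that is used for families of swaps: with
    p = e^(-t) / 2 <= 1/2 both 1 - eta and 1 - p are at least 1/2. The factor 4
    in front of [q] is 2 for the permutations of the labels and 2 for this 1/2. *)
Lemma swaps_bound (A : finType) (X : A -> {set 'I_N}) (d : nat) (q t : R) :
  (0 < #|A|)%N -> 0 <= t -> (forall a, #|X a| <= d)%N ->
  (forall that : labelling N.*2 2,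
     #|[set a | (disagree that (swapped (X a)))%:R <= xi * N%:R]|%:R <= q) ->
  4 * q <= expR (- t) * #|A|%:R ->
  t <= d.*2%:R * eps /\ ln (1 / (4 * eta)) <= d.*2%:R * eps.
Proof.
move=> A0 t0 Xd Hq qt.
have [eta0 eta2] := andP eta_le.
have near_X a : (#|[set i | pair_of i \in X a]| <= d.*2)%N.
  by rewrite card_pairs leq_double.
have cover that : #|[set a | that \in [set t | loss R t (swapped (X a)) <= xi]]|%:R
    <= expR (- t) / 2 * #|A|%:R.
  apply: (@le_trans _ _ (2 * q)); last by lra.
  by apply: count_loss_le; rewrite ?double_gt0 ?half_double.
have off_X a : {in ~: [set i | pair_of i \in X a],
    swapped (X a) =1 swapped finset.set0} by exact: swapped_eq0.
have [] := averaged_accuracy B01 dp near_X off_X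
  (fun a => acc (balanced_swapped (X a))) cover A0.
set E := expR (d.*2%:R * eps) => b1 b2.
have et1 : expR (- t) <= 1 by rewrite expR_le1 oppr_le0.
split.
  have : 0 <= d.*2%:R * eps - t; last by lra.
  by rewrite -ler_expR expR0 expRB -expRN -/E; lra.
rewrite -ler_expR lnK; last by rewrite posrE divr_gt0 // mulr_gt0.
by rewrite -/E ler_pdivrMr ?mulr_gt0 //; lra.
Qed.

(** The family swaps one pair in each of [m] disjoint blocks of [l] pairs, hence
    has l^m members at distance 2m from the reference. Two choices in one block
    differ on four nodes, so [sum_expR_separated] applies with e^(-2 lambda) =
    1 / l: each block contributes at most 2 to the generating function, and the
    count is at most l^(m/2) 2^m. *)
Lemma sparse_bound (m l : nat) : (0 < m)%N -> (m * l <= N)%N ->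
  xi * N%:R <= m%:R -> (64 <= l)%N ->
  ln (l%:R / 64) <= 4 * eps /\ ln (1 / (4 * eta)) <= m.*2%:R * eps.
Proof.
move=> m0 mlN xim l64.
have mR : 0 < m%:R :> R by rewrite ltr0n.
have lR : 0 < l%:R :> R by rewrite ltr0n; lia.
have l64R : 1 <= l%:R / 64 :> R.
  by rewrite ler_pdivlMr // mul1r (ler_nat R 64).
have slot_le : (#|{: 'I_m * 'I_l}| <= N)%N by rewrite card_prod !card_ord.
pose slot (x : 'I_m * 'I_l) : 'I_N := widen_ord slot_le (enum_rank x).
have slot_inj : injective slot.
  by move=> x y /(congr1 val) /= /val_inj/enum_rank_inj.
pose X (a : {ffun 'I_m -> 'I_l}) : {set 'I_N} :=
  [set slot (j, a j) | j : 'I_m].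
have XE a j i : (slot (j, i) \in X a) = (i == a j).
  apply/imsetP/eqP => [[j' _ /slot_inj[-> ->]] //|->].
  by exists j.
pose h (that : labelling N.*2 2) (j : 'I_m) (b : 'I_l) :=
  (\sum_(i < l) pair_errors that (slot (j, i)) (i == b))%N.
have h_le that (a : {ffun 'I_m -> 'I_l}) :
    (\sum_j h that j (a j) <= disagree that (swapped (X a)))%N.
  rewrite disagree_swapped /h pair_bigA /=.
  rewrite (eq_bigr (fun x => pair_errors that (slot x) (slot x \in X a)));
    last by case=> j i _; rewrite XE.
  exact: leq_sum_inj.
have sep that j a b : a != b -> (4 <= h that j a + h that j b)%N.
  move=> ab.
  (* Choosing [c] swaps the pair [c] and leaves [c'] unswapped. The bounds for
     [a] and [b] together count both states of both pairs. *)
  have two c c' : c' != c -> (pair_errors that (slot (j, c)) true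
      + pair_errors that (slot (j, c')) false <= h that j c)%N.
    move=> cc; rewrite /h (bigD1 c) //= eqxx leq_add2l (bigD1 c') //=.
    by rewrite (negbTE cc) leq_addr.
  have := two b a ab; rewrite eq_sym in ab; have := two a b ab.
  have := pair_errors_sum that (slot (j, a)).
  have := pair_errors_sum that (slot (j, b)).
  by lia.
(* This choice balances the two terms 1 and l e^(-2 lambda). *)
pose lambda : R := ln l%:R / 2.
have lambda0 : 0 <= lambda by rewrite divr_ge0 // ln_ge0 // ler1n; lia.
have expl : expR (- lambda * 2) = l%:R^-1.
  by rewrite mulNr divfK // expRN lnK.
pose t : R := m%:R / 2 * ln (l%:R / 64).
have [] := @swaps_bound {ffun 'I_m -> 'I_l} X m
  (expR (lambda * (xi * N%:R)) * 2 ^+ m) t.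
- by rewrite card_ffun !card_ord expn_gt0; lia.
- by rewrite mulr_ge0 ?ln_ge0.
- by move=> a; rewrite (leq_trans (leq_imset_card _ _)) // card_ord.
- move=> that.
  apply: (@le_trans _ _ (expR (lambda * (xi * N%:R)) *
      \prod_(j < m) \sum_b expR (- lambda * (h that j b)%:R))).
    apply: le_trans (chernoff_count (h that) _ lambda0).
    rewrite ler_nat subset_leq_card //; apply/fintype.subsetP => a.
    by rewrite !inE; apply: le_trans; rewrite ler_nat.
  rewrite ler_wpM2l ?expR_ge0 // -[m in leRHS]card_ord -prodr_const.
  apply: ler_prod => j _; rewrite sumr_ge0 /= => [|b _]; last exact: expR_ge0.
  apply: le_trans (sum_expR_separated lambda0 (sep that j)) _.
  by rewrite expl card_ord mulfV ?gt_eqF.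
- (* The constant 64 = 8^2 in [t] leaves room for 4 * 2^m <= 8^m. *)
  have -> : expR (- t) * #|{ffun 'I_m -> 'I_l}|%:R
      = expR (lambda * m%:R) * 8 ^+ m.
    rewrite card_ffun !card_ord natrX -[in LHS](lnK (x := l%:R)) //.
    rewrite -[in RHS](lnK (x := 8)) ?posrE // -!expRM_natl -!expRD.
    congr expR; rewrite /t /lambda ln_div ?posrE //.
    have -> : 64 = 8 ^+ 2 :> R by rewrite -natrX.
    by rewrite lnXn //; field.
  rewrite mulrCA ler_pM ?expR_ge0 ?ler_expR ?ler_wpM2l //.
  have -> : 8 = 4 * 2 :> R by rewrite -natrM.
  rewrite exprMn ler_wpM2r ?exprn_ge0 // -[leLHS]expr1 ler_weXn2l //.
  by rewrite (ler_nat R 1).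
- move=> b1 b2; split=> //; rewrite -(ler_pM2l mR).
  by move: b1; rewrite /t -muln2 natrM; lra.
Qed.


(** All 2^N swaps are used. By [pair_errors_sum] the generating function of
    one pair is at most 1 + e^(-2 lambda) = 2 e^(-lambda) cosh lambda, and
    [coshR_le] with lambda = kappa / 2 gives a proportion of accurate members of
    at most e^(- kappa^2 N / 6). *)
Lemma dense_bound (kappa : R) : 0 < kappa <= 1 -> xi <= 1 - kappa ->
  48 <= kappa ^+ 2 * N%:R ->
  kappa ^+ 2 / 24 <= eps /\ ln (1 / (4 * eta)) <= N.*2%:R * eps.
Proof.
move=> /andP[kappa0 kappa1] xik Nk.
have NR : 0 < N%:R :> R by rewrite ltr0n.
pose X (a : {ffun 'I_N -> bool}) : {set 'I_N} := [set k | a k].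
pose lambda : R := kappa / 2.
have lambda0 : 0 <= lambda by rewrite /lambda; lra.
pose t : R := kappa ^+ 2 * N%:R / 12.
pose c : R := expR (- lambda) * (2 * expR (4 / 3 * lambda ^+ 2)).
have letter_le that (k : 'I_N) :
    \sum_b expR (- lambda * (pair_errors that k b)%:R) <= c.
  rewrite big_bool /=; move: (pair_errors_sum that k).
  move: (pair_errors that k true) (pair_errors that k false) => e1 e2 e12.
  apply: (@le_trans _ _ (expR (- lambda) * (expR lambda + expR (- lambda)))).
    have expE : - lambda * 2 = - lambda - lambda by ring.
    rewrite mulrDr -!expRD addNr.
    move: e1 e2 e12 => [|[|[|//]]] [|[|[|//]]] //= _.
    - by rewrite mulr0 expE expR0 lexx.
    - rewrite mulr1 expRD expR0.
      by have := sqr_ge0 (1 - expR (- lambda)); rewrite expr2; lra.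
    - by rewrite mulr0 expE expR0 addrC lexx.
  by rewrite ler_wpM2l ?expR_ge0 // coshR_le // /lambda; lra.
have [] := @swaps_bound {ffun 'I_N -> bool} X N
  (expR (lambda * (xi * N%:R)) * c ^+ N) t.
- by rewrite card_ffun card_bool card_ord expn_gt0.
- by rewrite /t; lra.
- by move=> a; rewrite -[leqRHS]card_ord max_card.
- move=> that.
  apply: (@le_trans _ _ (expR (lambda * (xi * N%:R)) *
      \prod_(k < N) \sum_b expR (- lambda * (pair_errors that k b)%:R))).
    apply: le_trans (chernoff_count (pair_errors that) _ lambda0).
    rewrite ler_nat subset_leq_card //; apply/fintype.subsetP => a.
    rewrite !inE disagree_swapped.
    by under eq_bigr do rewrite inE.
  rewrite ler_wpM2l ?expR_ge0 // -[N in leRHS]card_ord -prodr_const.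
  apply: ler_prod => k _; rewrite letter_le andbT.
  by rewrite sumr_ge0 // => b _; exact: expR_ge0.
- rewrite card_ffun card_bool card_ord natrX.
  have -> : c ^+ N = expR (N%:R * (kappa ^+ 2 / 3 - lambda)) * 2 ^+ N.
    have -> : c = expR (kappa ^+ 2 / 3 - lambda) * 2.
      rewrite /c mulrCA -expRD mulrC; congr (expR _ * _).
      by rewrite /lambda; field.
    by rewrite exprMn -expRM_natl.
  rewrite mulrA mulrA ler_wpM2r ?exprn_ge0 // -mulrA -expRD.
  have e4 : 4 <= expR 4 :> R by apply: le_trans (expR_ge1Dx _); lra.
  apply: le_trans (ler_wpM2r (expR_ge0 _) e4) _.
  rewrite -expRD ler_expR.
  have : lambda * (xi * N%:R) <= lambda * ((1 - kappa) * N%:R).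
    by rewrite ler_wpM2l // ler_wpM2r // ltW.
  rewrite /t /lambda; lra.
- move=> b1 b2; split=> //; rewrite -(ler_pM2l NR).
  by move: b1; rewrite /t -muln2 natrM; lra.
Qed.


Lemma double_natr : N.*2%:R = 2 * N%:R :> R.
Proof. by rewrite -muln2 natrM mulrC. Qed.

(** The sparse family with m = floor (xi N) + 1 <= 3 xi N blocks, which fill the
    N pairs up to rounding, so that l is at least 1 / (6 xi). The smallness of xi
    makes l / 64 at least (1 / xi)^(1/2). *)
Lemma privacy_bound_small : 400 * 400 * xi <= 1 ->
  ln (1 / xi) + ln (1 / (4 * eta)) / (xi * N.*2%:R) <= 11 * eps.
Proof.
move=> xi_small; have xi0 := xi_gt0; have eps0 := eps_ge0.
have NR : 0 < N%:R :> R by rewrite ltr0n.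
have xin0 : 0 < xi * N.*2%:R by rewrite mulr_gt0 // ltr0n double_gt0.
pose m := (Num.truncn (xi * N%:R)).+1; pose l := (N %/ m)%N.
have xiN0 : 0 <= xi * N%:R by rewrite mulr_ge0 ?ltW.
have /andP[m_ge m_le] := truncn_itv xiN0.
have mS : m%:R = (Num.truncn (xi * N%:R))%:R + 1 :> R by rewrite natr1.
(* xi >= 1 / n makes xi N at least 1/2, so adding 1 at most triples it. *)
have xin1 : 1 <= 2 * (xi * N%:R).
  have := xi_ge; rewrite -div1r ler_pdivrMr ?ltr0n ?double_gt0 //.
  by rewrite double_natr; lra.
have m3 : m%:R <= 3 * (xi * N%:R) by lra.
have mR : 0 < m%:R :> R by rewrite ltr0n.
(* N < (l + 1) m <= (l + 1) 3 xi N, divided by N. *)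
have l_big : 1 <= 3 * xi * (l%:R + 1).
  have NltR : N%:R < (l%:R + 1) * m%:R :> R.
    by rewrite natr1 -natrM ltr_nat ltn_ceil.
  rewrite -(ler_pM2r NR) mul1r; apply: le_trans (ltW NltR) _.
  rewrite [leRHS]mulrAC [leRHS]mulrC ler_wpM2l ?natr1 //.
  by lra.
have l64R : 64 <= l%:R :> R.
  rewrite leNgt; apply/negP => l_lt.
  have : xi * (l%:R + 1) <= xi * 65.
    by apply: ler_wpM2l; [exact: ltW | lra].
  by lra.
have l64 : (64 <= l)%N by rewrite -(ler_nat R).
have [||||aux bb] := @sparse_bound m l => //.
- by rewrite mulnC leq_divM.
- by rewrite ltW.
have u0 : 0 < l%:R / 64 :> R by lra.
have aa : ln (1 / xi) <= 8 * eps.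
  suff : ln (1 / xi) <= 2 * ln (l%:R / 64) by lra.
  rewrite mulr_natl -lnXn // ler_ln ?posrE ?divr_gt0 ?exprn_gt0 //.
  rewrite ler_pdivrMr //.
  have v1 : 1 <= 384 * xi * (l%:R / 64).
    have : xi * 1 <= xi * l%:R.
      by apply: ler_wpM2l; [exact: ltW | lra].
    by lra.
  move: (l%:R / 64) u0 v1 => u u0 v1.
  have w0 : 0 <= u ^+ 2 * xi by rewrite mulr_ge0 ?sqr_ge0 ?ltW.
  have vv := ler_pM ler01 ler01 v1 v1.
  have : 384 * 384 * xi <= 1 by lra.
  by move=> /(ler_wpM2r w0); lra.
have bbb : ln (1 / (4 * eta)) / (xi * N.*2%:R) <= 3 * eps.
  rewrite ler_pdivrMr //; apply: le_trans bb _.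
  rewrite -muln2 natrM double_natr.
  by have := ler_wpM2r eps0 m3; lra.
lra.
Qed.

(** Here log (1 / xi) and 1 / xi are bounded, so the constant lower bound on
    eps and the bound of order log (1 / eta) / n of [dense_bound] suffice. *)
Lemma privacy_bound_big (kappa : R) : 1 <= 400 * 400 * xi ->
  0 < kappa <= 1 -> xi <= 1 - kappa -> 48 <= kappa ^+ 2 * N%:R ->
  ln (1 / xi) + ln (1 / (4 * eta)) / (xi * N.*2%:R)
    <= 400 * 400 * (24 / kappa ^+ 2 + 1) * eps.
Proof.
move=> xi_big kappaP xik Nk; have /andP[kappa0 kappa1] := kappaP.
have xi0 := xi_gt0; have eps0 := eps_ge0.
have NR : 0 < N%:R :> R by rewrite ltr0n.
have xin0 : 0 < xi * N.*2%:R by rewrite mulr_gt0 // ltr0n double_gt0.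
have [e24 bb] := dense_bound kappaP xik Nk.
have aa : ln (1 / xi) <= 400 * 400 * (24 / kappa ^+ 2 * eps).
  have : ln (1 / xi) < 1 / xi by rewrite ln_sublinear // divr_gt0.
  have : 1 / xi <= 400 * 400 by rewrite ler_pdivrMr.
  have : 1 <= 24 / kappa ^+ 2 * eps.
    by rewrite -ler_pdivrMl ?divr_gt0 ?exprn_gt0 // invf_div mulr1.
  by lra.
have bbb : ln (1 / (4 * eta)) / (xi * N.*2%:R) <= 400 * 400 * eps.
  rewrite ler_pdivrMr //; apply: le_trans bb _.
  have := ler_wpM2r (mulr_ge0 (ler0n R N.*2) eps0) xi_big.
  by lra.
lra.
Qed.

Lemma privacy_bound (kappa : R) : 0 < kappa <= 1 -> xi <= 1 - kappa ->
  48 <= kappa ^+ 2 * N%:R ->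
  kappa ^+ 2 / (400 * 400 * 25) *
    (ln (1 / xi) + ln (1 / (4 * eta)) / (xi * N.*2%:R)) <= eps.
Proof.
move=> kappaP xik Nk; have /andP[kappa0 kappa1] := kappaP.
have eps0 := eps_ge0.
have k20 : 0 < kappa ^+ 2 by rewrite exprn_gt0.
have k21 : kappa ^+ 2 <= 1 by rewrite expr_le1 // ltW.
rewrite mulrAC ler_pdivrMr; last by lra.
have [xi_small|/ltW xi_big] := leP (400 * 400 * xi) 1.
  apply: le_trans (ler_wpM2l (ltW k20) (privacy_bound_small xi_small)) _.
  have := ler_wpM2r eps0 k21; lra.
apply: le_trans (ler_wpM2l (ltW k20) (privacy_bound_big xi_big kappaP xik Nk)) _.
have -> : kappa ^+ 2 * (400 * 400 * (24 / kappa ^+ 2 + 1) * eps)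
    = 400 * 400 * (24 + kappa ^+ 2) * eps.
  by field; rewrite gt_eqF.
have := ler_wpM2r eps0 k21; lra.
Qed.

End LowerBound.

(** * Asymptotics *)

#[local] Instance even_infty_filter : Filter even_infty.
Proof. exact: within_filter. Qed.

Lemma near_even_infty (P : nat -> Prop) :
  (\forall n \near \oo%classic, P n) -> \forall n \near even_infty, P n.
Proof. exact: cvg_within. Qed.

Lemma near_even : \forall n \near even_infty, ~~ odd n.
Proof. exact: withinT. Qed.

Section Rates.
Variables (R : realType) (F : set_system nat).
Context {FF : Filter F}.

Definition diverges (L : nat -> R) := forall r, \forall n \near F, r <= L n.

Lemma diverges_ln (L : nat -> R) :
  diverges L -> diverges (fun n => ln (L n)).
Proof.
move=> dL r; apply: filterS (dL (expR r)) => n Ln.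
by rewrite -[r]expRK ler_ln ?posrE ?(lt_le_trans _ Ln) ?expR_gt0.
Qed.

(** Halving the exponent absorbs the multiplicative constant of [gtrsim], as
    [L] tends to infinity. *)
Lemma near_half_rate (f L : nat -> R) (a : R) : 0 < a -> diverges L ->
  gtrsim F (fun n => expR (- (a * L n))) f ->
  \forall n \near F, f n <= expR (- (a / 2 * L n)).
Proof.
move=> a0 dL [c c0 cf]; near=> n.
have Ln : - ln c / (a / 2) <= L n by near: n; exact: dL.
have cfn : c * f n <= expR (- (a * L n)) by near: n.
rewrite -(ler_pM2l c0); apply: le_trans cfn _.
rewrite -(lnK (x := c)) ?posrE // -expRD ler_expR.
by move: Ln; rewrite ler_pdivrMr ?divr_gt0 //; lra.
Unshelve. all: by end_near. Qed.

Lemma near_expR_small (L : nat -> R) (a e : R) : 0 < a -> 0 < e ->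
  diverges L -> \forall n \near F, expR (- (a * L n)) <= e.
Proof.
move=> a0 e0 dL; apply: filterS (dL (- ln e / a)) => n.
rewrite ler_pdivrMr // => Ln.
by rewrite -[e]lnK ?posrE // ler_expR; lra.
Qed.

End Rates.

Lemma diverges_natr (R : realType) : diverges even_infty (fun n => n%:R : R).
Proof. by move=> r; apply: near_even_infty; exact: nbhs_infty_ger. Qed.

Lemma near_rate_inv_poly (R : realType) (f : nat -> R) :
  asymp_inv_poly even_infty f ->
  exists2 a : R, 0 < a & \forall n \near even_infty, f n <= expR (- (a * ln n%:R)).
Proof.
move=> [a a0 [_ [c c0 cf]]]; exists (a / 2); first by rewrite divr_gt0.
apply: near_half_rate a0 (diverges_ln (@diverges_natr R)) _.
exists c => //; near=> n.
have n1 : 1 <= n%:R :> R by near: n; exact: diverges_natr.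
have -> : expR (- (a * ln n%:R)) = (n%:R `^ a)^-1.
  by rewrite expRN /powR gt_eqF //; lra.
by near: n.
Unshelve. all: by end_near. Qed.

Lemma gtrsim_privacy (R : realType) (eps eta xi : nat -> R) (B : nat -> 'M[R]_2)
  (hB : \forall n \near even_infty, connectivity (B n))
  (heta : \forall n \near even_infty, 0 < eta n <= 2^-1)
  (hxi : \forall n \near even_infty, n%:R^-1 <= xi n)
  (hM : \forall n \near even_infty,
     exists2 M : algorithm R n (labelling n 2),
       node_dp (eps n) 0 M &
       forall theta : labelling n 2, balanced theta ->
         1 - eta n <=
         sbm_prob (B n) theta M [set that | loss R that theta <= xi n])
  (kappa : R) :
  0 < kappa -> (\forall n \near even_infty, xi n <= 1 - kappa) ->
  gtrsim even_infty eps
    (fun n => ln (1 / xi n) + ln (1 / (4 * eta n)) / (xi n * n%:R)).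
Proof.
move=> kappa0 xik.
(* Only kappa <= 1 is meaningful, as xi is positive. *)
pose k := Num.min kappa 1.
have k0 : 0 < k by rewrite lt_min kappa0 ltr01.
have k1 : k <= 1 by rewrite ge_min lexx orbT.
have kk : k <= kappa by rewrite ge_min lexx.
exists (k ^+ 2 / (400 * 400 * 25)).
  by rewrite divr_gt0 ?exprn_gt0 //; lra.
near=> n.
have Bn : connectivity (B n) by near: n.
have etan : 0 < eta n <= 2^-1 by near: n.
have xin : n%:R^-1 <= xi n by near: n.
have xikn : xi n <= 1 - kappa by near: n.
have n_even : ~~ odd n by near: n; exact: near_even.
have n_big : 96 / k ^+ 2 <= n%:R by near: n; exact: diverges_natr.
have Mn : exists2 M : algorithm R n (labelling n 2), node_dp (eps n) 0 M &
    forall theta : labelling n 2, balanced theta ->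
      1 - eta n <= sbm_prob (B n) theta M [set that | loss R that theta <= xi n].
  by near: n.
move: (even_halfK n_even) => nE.
move: (eps n) (eta n) (xi n) (B n) Bn etan xin xikn n_big Mn => e h x b.
rewrite -nE; move: n./2 => N Bn etan xin xikn n_big [M dp acc].
have [_ _ B01] := Bn.
have Nk : 48 <= k ^+ 2 * N%:R.
  by move: n_big; rewrite double_natr ler_pdivrMr ?exprn_gt0 //; lra.
have N0 : (0 < N)%N.
  by rewrite lt0n; apply/negP => /eqP N0; move: Nk; rewrite N0 mulr0; lra.
have kP : 0 < k <= 1 by rewrite k0.
have xk : x <= 1 - k by lra.
exact: (privacy_bound N0 B01 etan xin dp acc kP xk Nk).
Unshelve. all: by end_near. Qed.

(** Eventually 4 eta <= 1 makes the second term of the bound nonnegative,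
    and the rate of xi bounds the first one below by a multiple of [L]. *)
Lemma gtrsim_vanishing (R : realType) (eps eta xi L : nat -> R) (a b : R) :
  (\forall n \near even_infty, 0 < eta n <= 2^-1) ->
  (\forall n \near even_infty, n%:R^-1 <= xi n) ->
  ((exists2 kappa : R, 0 < kappa &
         \forall n \near even_infty, xi n <= 1 - kappa) ->
      gtrsim even_infty eps
        (fun n => ln (1 / xi n) + ln (1 / (4 * eta n)) / (xi n * n%:R))) ->
  0 < a -> diverges even_infty L ->
  (\forall n \near even_infty, xi n <= expR (- (a * L n))) ->
  0 < b ->
  (\forall n \near even_infty, eta n <= expR (- (b * ln n%:R))) ->
  gtrsim even_infty eps L.
Proof.
move=> heta hxi bound a0 dL xiL b0 etaL.
have [|c c0 Hc] := bound.
  exists (1 / 2); first by lra.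
  near=> n.
  have xin : xi n <= expR (- (a * L n)) by near: n.
  apply: le_trans xin _.
  by near: n; apply: near_expR_small => //; lra.
exists (c * a); first by rewrite mulr_gt0.
near=> n.
have /andP[eta0 _] : 0 < eta n <= 2^-1 by near: n.
have n1 : 1 <= n%:R :> R by near: n; exact: diverges_natr.
have n0 : 0 < n%:R :> R by lra.
have xi0 : 0 < xi n.
  by apply: lt_le_trans (_ : n%:R^-1 <= _); [rewrite invr_gt0 | near: n].
have eta4 : eta n <= 1 / 4.
  have etan : eta n <= expR (- (b * ln n%:R)) by near: n.
  apply: le_trans etan _; near: n.
  by apply: near_expR_small => //; exact: diverges_ln (@diverges_natr R).
have xin : xi n <= expR (- (a * L n)) by near: n.
have : c * (ln (1 / xi n) + ln (1 / (4 * eta n)) / (xi n * n%:R)) <= eps n.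
  by near: n.
apply: le_trans; rewrite -mulrA ler_wpM2l ?(ltW c0) //.
apply: ler_wpDr.
  apply: divr_ge0; last by rewrite mulr_ge0 // ltW.
  by rewrite ln_ge0 // ler_pdivlMr ?mulr_gt0 //; lra.
rewrite -[a * L n]expRK ler_ln ?posrE ?expR_gt0 ?divr_gt0 //.
by rewrite ler_pdivlMr // -ler_pdivlMl ?expR_gt0 // mulr1 -expRN.
Unshelve. all: by end_near. Qed.

Unset Implicit Arguments.

Theorem corollary2 (R : realType) (eps eta xi : nat -> R) (B : nat -> 'M[R]_2)
  (hB : \forall n \near even_infty, connectivity (B n))
  (heta : \forall n \near even_infty, 0 < eta n <= 2^-1)
  (hxi : \forall n \near even_infty, n%:R^-1 <= xi n)
  (hM : \forall n \near even_infty,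
     exists2 M : algorithm R n (labelling n 2),
       node_dp (eps n) 0 M &
       forall theta : labelling n 2, balanced theta ->
         1 - eta n <=
         sbm_prob (B n) theta M [set that | loss R that theta <= xi n]) :
  [/\ (exists2 kappa : R, 0 < kappa &
         \forall n \near even_infty, xi n <= 1 - kappa) ->
      gtrsim even_infty eps
        (fun n => ln (1 / xi n) + ln (1 / (4 * eta n)) / (xi n * n%:R)),
      asymp_inv_poly even_infty xi -> asymp_inv_poly even_infty eta ->
      gtrsim even_infty eps (fun n => ln n%:R) &
      asymp_inv_poly even_infty eta ->
      asymp_eq even_infty xi (fun n => 1 / ln n%:R) ->
      gtrsim even_infty eps (fun n => ln (ln n%:R))].
Proof.
have dln : diverges even_infty (fun n => ln n%:R : R).
  exact: diverges_ln (@diverges_natr R).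
have bound : (exists2 kappa : R, 0 < kappa &
         \forall n \near even_infty, xi n <= 1 - kappa) ->
      gtrsim even_infty eps
        (fun n => ln (1 / xi n) + ln (1 / (4 * eta n)) / (xi n * n%:R)).
  by move=> [kappa kappa0 xik]; exact: (gtrsim_privacy hB heta hxi hM kappa0 xik).
split=> // [xi_poly eta_poly|eta_poly [_ [c c0 xi_log]]].
- have [a a0 xi_a] := near_rate_inv_poly xi_poly.
  have [b b0 eta_b] := near_rate_inv_poly eta_poly.
  exact: (gtrsim_vanishing heta hxi bound a0 dln xi_a b0 eta_b).
- have [b b0 eta_b] := near_rate_inv_poly eta_poly.
  have dlnln : diverges even_infty (fun n => ln (ln n%:R) : R).
    exact: diverges_ln dln.
  have half0 : 0 < 1 / 2 :> R by lra.
  have xi_half : \forall n \near even_infty,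
      xi n <= expR (- (1 / 2 * ln (ln n%:R))).
    apply: near_half_rate ltr01 dlnln _; exists c => //; near=> n.
    have ln1 : 1 <= ln n%:R :> R by near: n; exact: dln.
    rewrite mul1r expRN lnK ?posrE; last by lra.
    rewrite -div1r.
    by near: n.
  exact: (gtrsim_vanishing heta hxi bound half0 dlnln xi_half b0 eta_b).
Unshelve. all: by end_near. Qed.
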